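(* Let $k$ be an integer and $m$ a positive integer. For each nonnegative integer $n$ set $$u_n=\genfrac{[}{]}{0pt}{}{n}{\lfloor (k+n)/2\rfloor}_m\quad\text{and}\quad v_n=m u_n-2^n-\delta_{n,0}\,\delta_{(-1)^m,1}\,(-1)^{\lfloor k/2\rfloor}.$$ Then $$\sum_{i=0}^{\lfloor (m-1)/2\rfloor}(-1)^i\binom{m-1-i}{i}u_{n-2i}=2^{n-m+1}-\delta_{m-2,\,n}\frac{(-1)^{\lfloor (k+m)/2\rfloor}}{2}$$ for every integer $n\ge 2\lfloor (m-1)/2\rfloor$. Also, $(v_n)_{n\ge 0}$ is a linear recurrence sequence, satisfying the recurrence $$\sum_{i=0}^{\lfloor (m-1)/2\rfloor}(-1)^i\binom{m-1-i}{i}v_{n-2i}=0\quad\text{for all integers } n\ge 2\left\lfloor\frac{m-1}{2}\right\rfloor.$$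
   Context: For a positive integer $m$, a nonnegative integer $n$ and an integer $r$, define $$\genfrac{[}{]}{0pt}{}{n}{r}_m=\sum_{\substack{0\le k\le n\\ k\equiv r\ (\mathrm{mod}\ m)}}\binom nk .$$ The Kronecker symbol $\delta_{a,b}$ is $1$ if $a=b$ and $0$ otherwise (so $\delta_{(-1)^m,1}$ is $1$ if $m$ is even and $0$ if $m$ is odd). $\lfloor\alpha\rfloor$ is the integral part (floor) of the real number $\alpha$. *)

(* Defs.v *)
From mathcomp Require Import all_boot all_order all_algebra.

Set Implicit Arguments.
Unset Strict Implicit.
Unset Printing Implicit Defensive.

Import Order.TTheory GRing.Theory Num.Theory.
Local Open Scope ring_scope.

Definition binom_residue_sum (m n : nat) (r : int) : nat :=
  (\sum_(j < n.+1 | (Posz j == r %[mod Posz m])%Z) 'C(n, j))%N.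

(* [divz] by a positive divisor rounds towards -oo, so [(x %/ 2)%Z] is the
   floor of x / 2, also for negative x. *)
Definition u_seq (k : int) (m n : nat) : nat :=
  binom_residue_sum m n ((k + n%:Z) %/ 2)%Z.

(* Exponents such as [(k %/ 2)%Z] are integers; [^] is integer exponentiation,
   and -1 is a unit of [int]. *)
Definition v_seq (k : int) (m n : nat) : int :=
  m%:Z * (u_seq k m n)%:Z - 2 ^+ n
  - (n == 0)%N%:R * ((-1) ^+ m == 1 :> int)%:R * (-1) ^ (k %/ 2)%Z.

(* Homogeneous linear recurrence with constant coefficients, of some positive
   order d.+1, valid from the first term on and with nonzero last
   coefficient. *)
Definition is_linear_recurrence (R : idomainType) (w : nat -> R) : Prop :=
  exists (d : nat) (c : 'I_d.+1 -> R),
    c ord_max != 0 /\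
    forall n : nat, w (n + d.+1)%N = \sum_(j < d.+1) c j * w (n + d - j)%N.

(* Main.v *)
Require Import Defs.
From HB Require Import structures.
From mathcomp Require Import all_boot all_order all_algebra.
From mathcomp Require Import zify ring.

Import Order.TTheory GRing.Theory Num.Theory.
Local Open Scope ring_scope.

(** Let S_r(P) denote the sum of the coefficients of the polynomial P over the
    indices congruent to r modulo m; it is linear in P. Since floor((k+n-2i)/2)
    is floor((k+n)/2) - i, and multiplying by X^i shifts residues by i,
      u_(n-2i) = S_r(X^i (1+X)^(n-2i))   with r = floor((k+n)/2),
    where r is independent of i. Writing d = m-1 and
    c_i = (-1)^i binom(d-i,i), the left-hand side of the first identity is
    therefore S_r(P_n) with
      P_n = sum_(i <= d/2) c_i X^i (1+X)^(n-2i)   ([cheb_sum_u_seq]).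

    The c_i express the complete homogeneous polynomial
    sum_(a <= d) x^(d-a) y^a through xy and x+y ([cheb_sum_complete2]); at
    x = 1, y = X this says that P_d = 1 + X + ... + X^d. Hence for n >= d
      P_n = (1+X)^(n-d) (1 + X + ... + X^(m-1)),
    and S_r(Q (1 + ... + X^(m-1))) = Q(1) for every Q, because the m shifts of
    each coefficient of Q meet each residue class exactly once
    ([residue_sum_geometric]). So the sum is 2^(n-d).

    The range n >= 2 floor(d/2) contains one further value, n = d-1 with m even.
    There (1+X) P_n = P_d, and cancelling 1+X leaves
    P_n = 1 + X^2 + ... + X^(m-2) ([cheb_poly_even]). As m is even, S_r(P_n) is
    1 or 0 according to the parity of r, which is what the term with the
    Kronecker symbol records.

    For v_n one also needs sum_i c_i 2^(n-2i), which is P_n(1), the same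
    polynomial evaluated at 1: it is m 2^(n-d), or m/2 in the exceptional case.
    It cancels m times the sum for u_n, except when n = d-1; there the
    remainder is compensated by the correction in v_0, which only the last
    summand i = n/2 sees ([cheb_sum_v_seq]). Finally, c_0 = 1 and the last c_i
    is nonzero, so the relation can be solved for v_n
    ([is_linear_recurrence_even_steps]). *)

(** * Chebyshev-type coefficients *)

Lemma sum_even_odd (V : nmodType) (N : nat) (F : nat -> V) :
  \sum_(j < 2 * N) F j = \sum_(i < N) (F (2 * i)%N + F (2 * i).+1).
Proof.
elim: N => [|N IHN]; first by rewrite !big_ord0.
by rewrite mulnS !big_ord_recr /= IHN addrA.
Qed.

(** Up to powers of 2, the coefficients of the Chebyshev polynomial of the second
    kind of degree d. *)
Definition cheb_coef (R : pzRingType) (d i : nat) : R := (-1) ^+ i * 'C(d - i, i)%:R.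

Lemma cheb_coef_eq0 (R : pzRingType) (d i : nat) :
  (d < 2 * i)%N -> cheb_coef R d i = 0.
Proof. by move=> lt_di; rewrite /cheb_coef bin_small ?mulr0 //; lia. Qed.

Lemma cheb_coef0 (R : pzRingType) (d : nat) : cheb_coef R d 0 = 1.
Proof. by rewrite /cheb_coef bin0 mulr1. Qed.

(** Pascal's rule, read as the three-term recurrence of Chebyshev polynomials. *)
Lemma cheb_coefS (R : pzRingType) (d i : nat) :
  cheb_coef R d.+2 i.+1 = cheb_coef R d.+1 i.+1 - cheb_coef R d i.
Proof.
rewrite /cheb_coef subSS [(d.+1 - i.+1)%N]subSS.
have [le_id | lt_di] := leqP i d.
  by rewrite subSn // binS natrD mulrDr [in X in _ + X = _]exprS mulN1r mulNr.
have -> : (d.+1 - i = 0)%N by lia.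
have -> : (d - i = 0)%N by lia.
by rewrite !bin_small ?mulr0 ?subr0 //; lia.
Qed.

Lemma cheb_sum_widen (R : pzRingType) (d N : nat) (F : nat -> R) :
  (d %/ 2 < N)%N ->
  \sum_(i < N) cheb_coef R d i * F i
  = \sum_(i < (d %/ 2).+1) cheb_coef R d i * F i.
Proof.
move=> ltdN; rewrite [RHS](big_ord_widen N (fun i => cheb_coef R d i * F i)) //.
rewrite [RHS]big_mkcond /=; apply: eq_bigr => i _.
by case: ltnP => // lt_di; rewrite cheb_coef_eq0 ?mul0r //; lia.
Qed.

(** Both sides satisfy F_(d+2) = (x+y) F_(d+1) - xy F_d, as the recurrence with
    roots x and y, and agree for d = 0 and d = 1. *)
Lemma cheb_sum_complete2 (R : comPzRingType) (d : nat) (x y : R) :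
  \sum_(i < (d %/ 2).+1) cheb_coef R d i * ((x * y) ^+ i * (x + y) ^+ (d - 2 * i))
  = \sum_(a < d.+1) x ^+ (d - a) * y ^+ a.
Proof.
(* The number N of terms is kept free so that the sums for e, e+1 and e+2 can
   be matched term by term; the extra terms vanish. *)
pose T e N := \sum_(i < N)
  cheb_coef R e i * ((x * y) ^+ i * (x + y) ^+ (e - 2 * i)).
pose H e := \sum_(a < e.+1) x ^+ (e - a) * y ^+ a.
have TS e N : T e.+2 N.+1 = (x + y) * T e.+1 N.+1 - x * y * T e N.
  rewrite /T !big_ord_recl !cheb_coef0 !muln0 !subn0 !expr0 mulrDr -addrA.
  congr (_ + _); first by rewrite exprS; ring.
  rewrite !mulr_sumr -sumrB; apply: eq_bigr => i _.
  rewrite !lift0 cheb_coefS.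
  have -> : (e.+2 - 2 * i.+1 = e - 2 * i)%N by lia.
  have [le_i | lt_e] := leqP (2 * i.+1) e.+1.
    have -> : (e - 2 * i = (e.+1 - 2 * i.+1).+1)%N by lia.
    by rewrite !exprS; ring.
  (* The exponent of x + y is truncated here, but its coefficient is 0. *)
  by rewrite (cheb_coef_eq0 _ _ _ lt_e) sub0r exprS; ring.
have HS e : H e.+1 = x * H e + y ^+ e.+1.
  rewrite /H big_ord_recr /= subnn mul1r mulr_sumr; congr (_ + _).
  apply: eq_bigr => i _; rewrite subSn ?exprS ?mulrA //.
  by rewrite -ltnS.
have HSS e : H e.+2 = (x + y) * H e.+1 - x * y * H e.
  by rewrite !HS !exprS; ring.
have Twiden e N : (e %/ 2 < N)%N -> T e N = T e (e %/ 2).+1.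
  exact: (cheb_sum_widen R e N (fun i => (x * y) ^+ i * (x + y) ^+ (e - 2 * i))).
change (T d (d %/ 2).+1 = H d).
suff : T d (d %/ 2).+1 = H d /\ T d.+1 (d.+1 %/ 2).+1 = H d.+1 by case.
elim: d => [|d [IH0 IH1]].
  rewrite /T /H !(divn_small, big_ord_recl, big_ord0) //= !cheb_coef0.
  by split; rewrite /bump /=; rewrite ?subn0 ?muln0 ?subn0 ?subnn; ring.
split=> //; rewrite -(Twiden d.+2 d.+3); last by lia.
by rewrite TS HSS -IH0 -IH1 !Twiden //; lia.
Qed.

(** * The polynomial behind the alternating sums *)

Lemma cheb_coefC (R : nzRingType) (d i : nat) :
  (cheb_coef R d i)%:P = cheb_coef {poly R} d i.
Proof. by rewrite /cheb_coef rmorphM rmorphXn rmorphN1 rmorph_nat. Qed.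

Definition cheb_poly (R : nzRingType) (d n : nat) : {poly R} :=
  \sum_(i < (d %/ 2).+1)
    cheb_coef R d i *: ('X^i * (1 + 'X) ^+ (n - 2 * i)).

Lemma cheb_poly_geometric (R : comNzRingType) (d : nat) :
  cheb_poly R d d = \sum_(a < d.+1) 'X^a.
Proof.
transitivity (\sum_(a < d.+1) 1 ^+ (d - a) * 'X^a : {poly R}); last first.
  by apply: eq_bigr => a _; rewrite expr1n mul1r.
rewrite -cheb_sum_complete2; apply: eq_bigr => i _.
by rewrite -mul_polyC cheb_coefC mul1r.
Qed.

Lemma cheb_polyD (R : comNzRingType) (d n e : nat) : (2 * (d %/ 2) <= n)%N ->
  cheb_poly R d (n + e) = (1 + 'X) ^+ e * cheb_poly R d n.
Proof.
move=> le_dn; rewrite mulr_sumr; apply: eq_bigr => i _.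
rewrite (_ : n + e - 2 * i = e + (n - 2 * i))%N; last by have := ltn_ord i; lia.
by rewrite exprD -scalerAr mulrCA.
Qed.

Lemma cheb_poly_factor (R : comNzRingType) (d n : nat) : (d <= n)%N ->
  cheb_poly R d n = (1 + 'X) ^+ (n - d) * \sum_(a < d.+1) 'X^a.
Proof.
by move=> le_dn; rewrite -{1}(subnKC le_dn) cheb_polyD ?cheb_poly_geometric //; lia.
Qed.

(** For odd degree 2h+1 the sum stops at i = h, so n = 2h is still admissible, one
    below the degree; the value there is obtained by cancelling 1 + X from
    1 + X + ... + X^(2h+1) = (1 + X) (1 + X^2 + ... + X^(2h)). *)
Lemma cheb_poly_even (R : idomainType) (h : nat) :
  cheb_poly R (2 * h).+1 (2 * h) = \sum_(a < h.+1) 'X^(2 * a).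
Proof.
have nz : 1 + 'X != 0 :> {poly R} by rewrite addrC -polyC1 monic_neq0 ?monicXaddC.
apply: (mulfI nz).
rewrite -[X in X * _ = _]expr1 -cheb_polyD; last by lia.
rewrite addn1 cheb_poly_geometric mulr_sumr.
rewrite -[(2 * h).+2]/(2 + 2 * h)%N -mulnS (sum_even_odd _ _ (fun a => 'X^a)).
by apply: eq_bigr => i _; rewrite exprS mulrDl mul1r.
Qed.

Lemma horner1_sum_Xn (R : comNzRingType) (n : nat) (F : nat -> nat) :
  (\sum_(a < n) 'X^(F a) : {poly R}).[1] = n%:R.
Proof.
rewrite horner_sum; under eq_bigr do rewrite hornerXn expr1n.
by rewrite sumr_const card_ord.
Qed.

Lemma cheb_sum_exp2 (R : comNzRingType) (d n : nat) :
  \sum_(i < (d %/ 2).+1) cheb_coef R d i * 2 ^+ (n - 2 * i)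
  = (cheb_poly R d n).[1].
Proof.
rewrite horner_sum; apply: eq_bigr => i _.
by rewrite hornerZ hornerM hornerXn horner_exp hornerD hornerX hornerC expr1n mul1r.
Qed.

Lemma cheb_sum_exp2_ge (R : comNzRingType) (d n : nat) : (d <= n)%N ->
  \sum_(i < (d %/ 2).+1) cheb_coef R d i * 2 ^+ (n - 2 * i)
  = d.+1%:R * 2 ^+ (n - d).
Proof.
move=> le_dn; rewrite cheb_sum_exp2 cheb_poly_factor // hornerM mulrC.
rewrite (horner1_sum_Xn R _ id).
by rewrite horner_exp hornerD hornerX hornerC.
Qed.

Lemma cheb_sum_exp2_even (R : idomainType) (h : nat) :
  \sum_(i < h.+1) cheb_coef R (2 * h).+1 i * 2 ^+ (2 * h - 2 * i) = h.+1%:R.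
Proof.
have := cheb_sum_exp2 R (2 * h).+1 (2 * h).
have -> : ((2 * h).+1 %/ 2 = h)%N by lia.
by move=> ->; rewrite cheb_poly_even (horner1_sum_Xn R _ (fun a => 2 * a)%N).
Qed.

(** * Coefficient sums over a residue class *)

Definition residue_sum (R : nzRingType) (m : nat) (r : int) (P : {poly R}) : R :=
  \sum_(j < size P | (Posz j == r %[mod Posz m])%Z) P`_j.

Lemma residue_sum_widen (R : nzRingType) (m : nat) (r : int) (P : {poly R}) N :
  (size P <= N)%N ->
  residue_sum R m r P = \sum_(j < N | (Posz j == r %[mod Posz m])%Z) P`_j.
Proof.
move=> leN; rewrite /residue_sum.
rewrite (big_ord_widen_cond N (fun j => (Posz j == r %[mod Posz m])%Z)
           (fun j => P`_j)) //.
rewrite [LHS]big_mkcondr; apply: eq_bigr => j _.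
by case: ltnP => // le; rewrite nth_default.
Qed.

Lemma residue_sum_is_linear (R : nzRingType) (m : nat) (r : int) :
  linear_for *%R (residue_sum R m r).
Proof.
move=> a P Q; pose N := maxn (size P) (size Q).
rewrite !(residue_sum_widen _ _ _ _ N) ?leq_maxl ?leq_maxr //; last first.
  by rewrite (leq_trans (size_polyD _ _)) // geq_max leq_maxr leq_max size_scale_leq.
by rewrite mulr_sumr -big_split; apply: eq_bigr => j _; rewrite coefD coefZ.
Qed.

HB.instance Definition _ (R : nzRingType) (m : nat) (r : int) :=
  GRing.isLinear.Build R {poly R} R *%R (residue_sum R m r)
    (residue_sum_is_linear R m r).

Lemma residue_sumXn (R : nzRingType) (m : nat) (r : int) (n : nat) :
  residue_sum R m r 'X^n = (Posz n == r %[mod Posz m])%Z%:R.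
Proof.
rewrite /residue_sum size_polyXn big_mkcond /= (bigD1 ord_max) //= big1.
  by rewrite coefXn eqxx addr0; case: ifP.
move=> i; rewrite -val_eqE /= => /negPf ni.
by rewrite coefXn ni; case: ifP.
Qed.

Lemma residue_sum_binom (R : nzRingType) (m : nat) (r : int) (i n : nat) :
  residue_sum R m r ('X^i * (1 + 'X) ^+ n)
  = (binom_residue_sum m n (r - i%:Z))%:R.
Proof.
rewrite addrC exprD1n mulr_sumr linear_sum /= /binom_residue_sum natr_sum [RHS]big_mkcond.
apply: eq_bigr => j _.
rewrite mulrnAr -exprD linearMn /= residue_sumXn PoszD addrC.
rewrite -[X in (_ == X %[mod _])%Z](subrK i%:Z) eqz_modDr.
by case: ifP => _; rewrite ?mul0rn.
Qed.

Lemma sum_residue_class (R : nzRingType) (m : nat) (s : int) : (0 < m)%N ->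
  \sum_(a < m) (Posz a == s %[mod Posz m])%Z%:R = 1 :> R.
Proof.
move=> m_gt0; have mnz : Posz m != 0 by lia.
have [t Et] : exists t : 'I_m, (s %% m)%Z = Posz t.
  have := ltz_pmod s (m_gt0 : 0 < Posz m); have := modz_ge0 s mnz.
  by case: (s %% m)%Z => // t _ lt; exists (Ordinal lt).
rewrite (bigD1 t) //= Et modz_small ?eqxx ?big1 ?addr0 //.
- move=> a /negPf; rewrite -val_eqE /= => na.
  by rewrite modz_small ?eqz_nat ?na //= ltz_nat ltn_ord.
- by rewrite /= ltz_nat ltn_ord.
Qed.

(** Each coefficient of Q is shifted to m consecutive indices, exactly one of which
    lies in the class of r; the result is thus independent of r. *)
Lemma residue_sum_geometric (R : comNzRingType) (m : nat) (r : int) (Q : {poly R}) :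
  (0 < m)%N -> residue_sum R m r (Q * \sum_(a < m) 'X^a) = Q.[1].
Proof.
move=> m_gt0; rewrite -{1}[Q]coefK poly_def mulr_suml linear_sum horner_coef.
apply: eq_bigr => j _ /=; rewrite -scalerAl linearZ /= expr1n; congr (_ * _).
rewrite mulr_sumr linear_sum /= -[RHS](sum_residue_class R m (r - j%:Z) m_gt0).
apply: eq_bigr => a _; rewrite -exprD residue_sumXn PoszD addrC.
by rewrite -[X in (_ == X %[mod _])%Z](subrK j%:Z) eqz_modDr.
Qed.

(** The exponents run once through the even classes modulo 2(h+1): for even r,
    halving reduces to a full set of residues modulo h+1. *)
Lemma residue_sum_even (R : comNzRingType) (h : nat) (r : int) :
  residue_sum R (2 * h.+1) r (\sum_(a < h.+1) 'X^(2 * a)) = (2 %| r)%Z%:R.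
Proof.
rewrite linear_sum /=.
have [/dvdzP[q ->] | ndvd] := boolP (2 %| r)%Z; last first.
  rewrite big1 // => a _; rewrite residue_sumXn eqz_mod_dvd.
  case: dvdzP => //= -[q Eq].
  case/negP: ndvd; apply/dvdzP; exists (Posz a - q * h.+1%:Z); lia.
(* The right-hand side is 1, rewritten as the residue sum of
   1 + X + ... + X^h modulo h+1. *)
rewrite -[RHS](hornerC 1 1) -[RHS](residue_sum_geometric R h.+1 q) // mul1r linear_sum.
apply: eq_bigr => a _; rewrite /= !residue_sumXn !eqz_mod_dvd.
by rewrite !PoszM [q * _]mulrC -mulrBr dvdz_mul2l.
Qed.

(** * Alternating sums of the two sequences *)

(** Replacing n by n - 2i lowers floor((k+n)/2) by exactly i, which the factor X^i
    undoes; all terms are thus read off in the same residue class. *)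
Lemma cheb_sum_u_seq (R : nzRingType) (k : int) (m d n : nat) :
  (2 * (d %/ 2) <= n)%N ->
  \sum_(i < (d %/ 2).+1) cheb_coef R d i * (u_seq k m (n - 2 * i))%:R
  = residue_sum R m ((k + n%:Z) %/ 2)%Z (cheb_poly R d n).
Proof.
move=> le_dn; rewrite linear_sum; apply: eq_bigr => i _ /=.
rewrite linearZ /= residue_sum_binom /u_seq; do 3 congr (_ _).
by have := ltn_ord i; lia.
Qed.

Lemma cheb_sum_u_seq_ge (R : comNzRingType) (k : int) (d n : nat) : (d <= n)%N ->
  \sum_(i < (d %/ 2).+1) cheb_coef R d i * (u_seq k d.+1 (n - 2 * i))%:R
  = 2 ^+ (n - d).
Proof.
move=> le_dn; rewrite cheb_sum_u_seq; last by lia.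
rewrite cheb_poly_factor // residue_sum_geometric //.
by rewrite horner_exp hornerD hornerX hornerC.
Qed.

Lemma cheb_sum_u_seq_even (R : idomainType) (k : int) (h : nat) :
  \sum_(i < h.+1)
     cheb_coef R (2 * h).+1 i * (u_seq k (2 * h).+2 (2 * h - 2 * i))%:R
  = (2 %| (k %/ 2)%Z + h%:Z)%Z%:R.
Proof.
have := @cheb_sum_u_seq R k (2 * h).+2 (2 * h).+1 (2 * h).
have -> : ((2 * h).+1 %/ 2 = h)%N by lia.
move=> -> //; rewrite cheb_poly_even (_ : (2 * h).+2 = 2 * h.+1)%N; last by lia.
rewrite residue_sum_even.
by have -> : ((k + (2 * h)%:Z) %/ 2)%Z = (k %/ 2)%Z + h%:Z by lia.
Qed.

Lemma signz_dvd2 (R : unitRingType) (r : int) :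
  (-1) ^ r = 2 * (2 %| r)%Z%:R - 1 :> R.
Proof.
have u1 : (-1 : R) \is a GRing.unit by rewrite unitrN1.
have E q : (-1 : R) ^ (q * 2) = 1 by rewrite mulrC -exprz_exp -exprnP sqrrN expr1n exp1rz.
have [/dvdzP[q ->] | ndvd] := boolP (2 %| r)%Z; first by rewrite E mulr1 addrK.
have Er : r = (r %/ 2)%Z * 2 + 1 by lia.
by rewrite {1}Er exprzDr // E mul1r mulr0 sub0r.
Qed.

(** The relation is solved for its leading term, as a recurrence of order 2h whose
    coefficients at odd distances vanish. For h = 0 it forces w = 0, which
    satisfies any recurrence of order 1. *)
Lemma is_linear_recurrence_even_steps (R : idomainType) (h : nat) (a w : nat -> R) :
  a 0%N = 1 -> a h != 0 ->
  (forall n, (2 * h <= n)%N -> \sum_(i < h.+1) a i * w (n - 2 * i)%N = 0) ->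
  is_linear_recurrence w.
Proof.
move=> a0; case: h => [|h] ah rec.
  have w0 n : w n = 0.
    by have := rec n isT; rewrite big_ord1 a0 mul1r muln0 subn0.
  by exists 0%N, (fun=> 1); rewrite oner_neq0; split=> // n; rewrite big_ord1 !w0 mulr0.
(* Index j stands for distance j+1, so even distances are odd indices. *)
pose c (j : nat) := if odd j then - a (uphalf j) else 0.
exists (2 * h).+1, (fun j => c j); split.
  by rewrite /c /= mul2n odd_double /= oppr_eq0 doubleK.
move=> n; have := rec (n + (2 * h).+2)%N; rewrite big_ord_recl a0 mul1r.
move=> /(_ _)/eqP; rewrite addr_eq0 => /(_ _)/eqP.
rewrite -[(2 * h).+2]/(2 + 2 * h)%N -mulnS subn0 => -> //; last by lia.
rewrite (sum_even_odd _ _ (fun j => c j * w (n + (2 * h).+1 - j)%N)) -sumrN.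
apply: eq_bigr => i _; rewrite lift0.
have -> : c (2 * i)%N = 0 by rewrite /c mul2n odd_double.
have -> : c (2 * i).+1 = - a i.+1 by rewrite /c mul2n /= odd_double /= doubleK.
by rewrite mul0r add0r mulNr; congr (- (_ * w _)); lia.
Qed.

(** When n >= d the correction at index 0 does not contribute: m is odd, or
    n - 2i > 0 throughout. When d = 2h+1 and n = 2h, the correction enters through
    i = h with coefficient (-1)^h (h+1), and (-1)^(h + floor(k/2)) is 1 or -1
    according to the parity that decides the value of the sum for u. *)
Lemma cheb_sum_v_seq (k : int) (d n : nat) : (2 * (d %/ 2) <= n)%N ->
  \sum_(i < (d %/ 2).+1) cheb_coef int d i * v_seq k d.+1 (n - 2 * i) = 0.
Proof.
move=> le_hn; rewrite /v_seq.
under eq_bigr do rewrite !mulrBr (mulrCA _ d.+1%:Z) -[Posz (u_seq _ _ _)]natz.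
rewrite !sumrB -mulr_sumr -[Posz d.+1]natz.
have [le_dn | lt_nd] := leqP d n.
  rewrite cheb_sum_u_seq_ge // cheb_sum_exp2_ge // subrr sub0r big1 ?oppr0 // => i _.
  have [d_odd | d_even] := boolP (odd d); last first.
    by rewrite -signr_odd /= d_even mulr0n mulr0 mul0r mulr0.
  by rewrite (_ : (_ == 0)%N = false) ?mul0r ?mulr0 //; have := ltn_ord i; lia.
have [En Ed] : n = (2 * (d %/ 2))%N /\ d = (2 * (d %/ 2)).+1 by lia.
rewrite {}En {le_hn lt_nd}; move: (d %/ 2)%N Ed => h -> {d}.
rewrite cheb_sum_u_seq_even cheb_sum_exp2_even.
rewrite big_ord_recr /= big1 => [|i _]; last first.
  by rewrite (_ : (_ == 0)%N = false) ?mul0r ?mulr0 //; have := ltn_ord i; lia.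
have Esign : (-1) ^+ h * (-1) ^ (k %/ 2)%Z
    = 2 * (2 %| (k %/ 2)%Z + h%:Z)%Z%:R - 1 :> int.
  by rewrite -signz_dvd2 exprzDr ?unitrN1 // mulrC.
have -> : ((2 * h).+2 = 2 * h.+1)%N by lia.
rewrite subnn eqxx exprM sqrrN !expr1n eqxx !mul1r add0r natrM.
rewrite /cheb_coef (_ : (2 * h).+1 - h = h.+1)%N ?binSn; last by lia.
by rewrite [(-1) ^+ h * _ * _]mulrAC Esign; ring.
Qed.

Theorem corollary1p1 (k : int) (m : nat) (hm : (0 < m)%N) :
  [/\ forall n : nat, (2 * ((m - 1) %/ 2) <= n)%N ->
        \sum_(i < ((m - 1) %/ 2).+1)
           (-1) ^+ i * 'C(m - 1 - i, i)%:R * (u_seq k m (n - 2 * i))%:R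
        = (2 : rat) ^ (n%:Z - m%:Z + 1)
          - (m%:Z - 2 == n%:Z)%:R * ((-1) ^ ((k + m%:Z) %/ 2)%Z / 2),
      is_linear_recurrence (v_seq k m)
    & forall n : nat, (2 * ((m - 1) %/ 2) <= n)%N ->
        \sum_(i < ((m - 1) %/ 2).+1)
           (-1) ^+ i * 'C(m - 1 - i, i)%:R * v_seq k m (n - 2 * i)
        = 0].
Proof.
case: m hm => // d _; rewrite subn1 /=; split; last exact: cheb_sum_v_seq.
  move=> n le_hn.
  have [le_dn | lt_nd] := leqP d n.
    have := cheb_sum_u_seq_ge rat k d n le_dn; rewrite /cheb_coef => ->.
    rewrite (_ : (_ == _) = false) ?mul0r ?subr0; last by lia.
    by rewrite (_ : n%:Z - _ + 1 = (n - d)%N%:Z); last by lia.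
  have [En Ed] : n = (2 * (d %/ 2))%N /\ d = (2 * (d %/ 2)).+1 by lia.
  rewrite {}En {le_hn lt_nd}; move: (d %/ 2)%N Ed => h -> {d}.
  rewrite (cheb_sum_u_seq_even rat).
  rewrite (_ : (_ == (2 * h)%N%:Z) = true); last by lia.
  have -> : ((k + (2 * h).+2%:Z) %/ 2)%Z = (k %/ 2)%Z + h%:Z + 1 by lia.
  have -> : (2 * h)%N%:Z - (2 * h).+2%:Z + 1 = -1 by lia.
  rewrite exprzDr ?unitrN1 // signz_dvd2 exprN1 expr1z mul1r.
  by field.
apply: (is_linear_recurrence_even_steps _ (d %/ 2) (cheb_coef int d)).
- exact: cheb_coef0.
- rewrite /cheb_coef mulf_neq0 ?signr_eq0 // pnatr_eq0 -lt0n bin_gt0; lia.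
- exact: cheb_sum_v_seq.
Qed.
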